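(* There exists a complete connected economical metric space.
   Context: A metric space $(X,d)$ is economical if its metric $d$ is economical, that is, if $|d(A\times A)|\le \mathrm{dens}(A)$ for every infinite subset $A\subset X$, where $d(A\times A)=\{d(a,b)\colon a,b\in A\}$, $|\cdot|$ denotes cardinality, and $\mathrm{dens}(A)=\min\{|D|\colon D\subset A\subset \overline{D}\}$ is the density of $A$. *)

(* Defs.v *)
From HB Require Import structures.
From mathcomp Require Import all_boot all_order all_algebra.
From mathcomp Require Import boolp classical_sets functions cardinality reals.
From mathcomp Require Import topology.

Set Implicit Arguments.
Unset Strict Implicit.
Unset Printing Implicit Defensive.

Local Open Scope classical_set_scope.
Local Open Scope card_scope.

#[short(type="completeMetricType")]
HB.structure Definition CompleteMetric (R : numDomainType) :=
  {T of Complete T & Metric R T}.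

(* Zorn: a maximal family of choice functions on F that differ pairwise at
   every member of F must exhaust some member of F, which is then the least. *)
Lemma card_le_least (T : Type) (F : set (set T)) : F !=set0 ->
  exists2 A, F A & forall B, F B -> A #<= B.
Proof.
move=> [F0 FF0].
have [[B [FB B0]]|neF] := pselect (exists B, F B /\ B = set0).
  by exists B => // C _; rewrite B0.
have {}neF B : F B -> exists x, B x.
  move=> FB; have [//|nB] := pselect (exists x, B x).
  exfalso; apply: neF; exists B; split=> //.
  by apply/seteqP; split=> // x Bx; apply: nB; exists x.
have [t0 _] := neF _ FF0.
pose P (S : set (set T -> T)) :=
  (forall g B, S g -> F B -> B (g B)) /\
  (forall g h B, S g -> S h -> F B -> g B = h B -> g = h).
have [|S [[SF Sinj] maxS]] := @Zorn_bigcup _ P.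
  move=> G GP Gtot; split.
    by move=> g B [S GS Sg] FB; exact: (GP _ GS).1 _ _ Sg FB.
  move=> g h B [S GS Sg] [S' GS' S'h] FB.
  have [SS'|S'S] := Gtot _ _ GS GS'.
    exact: (GP _ GS').2 _ _ _ (SS' _ Sg) S'h FB.
  exact: (GP _ GS).2 _ _ _ Sg (S'S _ S'h) FB.
have [[A [FA AS]]|nA] :=
    pselect (exists A, F A /\ A `<=` [set g A | g in S]).
  exists A => // B FB.
  apply: (card_le_trans (subset_card_le AS)).
  apply: (card_le_trans (card_image_le _ _)).
  have [f] : $|{injfun S >-> B}|.
    apply/injfunPex; exists (fun g => g B); first by move=> g Sg; exact: SF Sg FB.
    by move=> g h; rewrite !inE => Sg Sh; exact: Sinj Sg Sh FB.
  exact: inj_card_le f.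
have new B : exists x, F B -> B x /\ forall g, S g -> g B <> x.
  have [FB|nFB] := pselect (F B); last by exists t0.
  apply: contrapT => nx; apply: nA; exists B; split=> // x Bx.
  apply: contrapT => nSx; apply: nx; exists x => _; split=> // g Sg gx.
  by apply: nSx; exists g.
have [g0 g0P] := choice new.
have nSg0 : ~ S g0.
  by move=> Sg0; have [_ /(_ _ Sg0)] := g0P _ FF0.
exfalso; apply: (maxS (S `|` [set g0])).
  by split=> [g Sg|/(_ g0 (or_intror erefl))]; first by left.
split=> [g B [Sg|->] FB|g h B [Sg|->] [Sh|->] FB gh //].
- exact: SF Sg FB.
- exact: (g0P _ FB).1.
- exact: (Sinj g h B).
- by have [_ /(_ _ Sg)] := g0P _ FB.
- by have [_ /(_ _ Sh)] := g0P _ FB; case.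
Qed.

Definition dense_subset (X : topologicalType) (A D : set X) :=
  D `<=` A /\ A `<=` closure D.

Lemma density_exists (X : topologicalType) (A : set X) :
  exists2 D, dense_subset A D & forall E, dense_subset A E -> D #<= E.
Proof.
by apply: card_le_least; exists A; split=> //; exact: subset_closure.
Qed.

(* There is no type of cardinals in the library, only the relation #<=, so the
   cardinal dens(A) is represented by a dense subset of A that attains it. *)
Definition density (X : topologicalType) (A : set X) : set X :=
  s2val (cid2 (density_exists A)).

Lemma densityP (X : topologicalType) (A : set X) :
  dense_subset A (density A) /\
  forall E, dense_subset A E -> density A #<= E.
Proof. by rewrite /density; case: cid2. Qed.

Definition distances (R : numDomainType) (X : metricType R) (A : set X) :
  set R := [set mdist p.1 p.2 | p in A `*` A].

Definition economical (R : numDomainType) (X : metricType R) :=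
  forall A : set X, infinite_set A -> distances A #<= density A.

(* Main.v *)
From HB Require Import structures.
Require Import Defs.
From mathcomp Require Import all_boot all_order all_algebra.
From mathcomp Require Import boolp classical_sets functions cardinality reals.
From mathcomp Require Import topology normedtype.
From mathcomp Require Import lra.

(* The space is self-similar.  A copy of it carries vertices [t] in [0, 1),
   pairwise far apart, and for all distinct [x], [y] in (0, 1) a smaller copy,
   the edge [(x, y)]: its vertex [0] is at distance at most [|x - y|] from [x],
   and its vertices [t] converge to [y] as [t -> 1].
     Connectedness: a clopen set that separates two vertices of a copy separates
   [x] from [y] for some [y] arbitrarily close to some [x], as (0, 1) is
   connected; hence it separates vertices of the edge [(x, y)].  Iterating gives
   nested copies shrinking to a point, by completeness, near which the clopen
   set is trivial.
     Economy: the distance between two distinct points depends only on finitely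
   many labels of their addresses, and every finite address of a point of the
   closure of [D] is, up to finitely many choices, one of a point of [D].  So
   for infinite [D] the distances in the closure of [D] number at most
   [|D x N|^2 = |D|]. *)

Set Implicit Arguments.
Unset Strict Implicit.
Unset Printing Implicit Defensive.

Import Order.TTheory GRing.Theory Num.Theory.
Import numFieldNormedType.Exports.

Local Open Scope classical_set_scope.
Local Open Scope card_scope.
Local Open Scope ring_scope.

(** * Squares of infinite cardinals *)

Lemma card_le_injective (T U : Type) (A : set T) (B : set U) (f : T -> U) :
  (forall x, A x -> B (f x)) ->
  (forall x y, A x -> A y -> f x = f y -> x = y) -> A #<= B.
Proof.
move=> fAB finj; have [g] : $|{injfun A >-> B}|.
  apply/injfunPex; exists f => // x y; rewrite !inE; exact: finj.
exact: inj_card_le g.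
Qed.

Lemma card_le_ex (T : Type) (U : pointedType) (A : set T) (B : set U) :
  A #<= B -> exists2 f : T -> U, (forall x, A x -> B (f x)) &
    (forall x y, A x -> A y -> f x = f y -> x = y).
Proof.
move=> /pcard_leP/injfunPex[f fAB finj]; exists f => // x y Ax Ay.
by apply: finj; rewrite inE.
Qed.

Lemma card_leX (T T' : Type) (U U' : pointedType) (A : set T) (B : set U)
    (A' : set T') (B' : set U') :
  A #<= B -> A' #<= B' -> A `*` A' #<= B `*` B'.
Proof.
move=> /card_le_ex[f fB fI] /card_le_ex[g gB gI].
apply: (@card_le_injective _ _ _ _ (fun p => (f p.1, g p.2))).
  by move=> p [/= p1 p2]; split; [exact: fB|exact: gB].
move=> [x y] [x' y'] [/= Ax Ay] [/= Ax' Ay'] [/fI-> // /gI->] //.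
Qed.

Lemma card_le_comparable (T : Type) (A B : set T) : A #<= B \/ B #<= A.
Proof.
have [|C [|] -> CP] := @card_le_least _ [set A; B].
- by exists A; left.
- by left; apply: CP; right.
- by right; apply: CP; left.
Qed.

Section square.
Variable T : pointedType.
Implicit Types A B C : set T.

Lemma card_setU_le A B C : infinite_set B -> B `*` B #<= B ->
  A #<= B -> C #<= B -> A `|` C #<= B.
Proof.
move=> Binf BB /card_le_ex[f fB fI] /card_le_ex[g gB gI].
have [b Bb] := infinite_setN0 Binf.
have [c Bc cb] : exists2 c, B c & c <> b.
  apply: contrapT => nc; apply: Binf; rewrite (_ : B = [set b]) //.
  apply/seteqP; split=> [x Bx|x ->//]; apply: contrapT => xb.
  by apply: nc; exists x.
apply: card_le_trans BB.
(* The distinct elements [b] and [c] of [B] tag the two parts of the union inside the square of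
   [B]. *)
pose k x := if pselect (A x) then (b, f x) else (c, g x).
apply: (@card_le_injective _ _ _ _ k) => [x|x y].
  rewrite /k; case: pselect => [Ax _|nAx [//|Cx]]; split=> //=; [exact: fB|].
  exact: gB.
rewrite /k; case: pselect => [Ax _|nAx [//|Cx]].
  by case: pselect => [Ay _ [/fI]|nAy [//|Cy] [/esym]] //; exact.
by case: pselect => [Ay _ [/cb]|nAy [//|Cy] [/gI]] //; exact.
Qed.

Let square_inj B (f : T * T -> T) :=
  (forall p, (B `*` B) p -> B (f p)) /\
  (forall p q, (B `*` B) p -> (B `*` B) q -> f p = f q -> p = q).

(** Injections are encoded by their graphs, so that a chain of them has its union as upper bound. *)
Let graph B (f : T * T -> T) : set (T * T * T) :=
  [set q | (B `*` B) q.1 /\ f q.1 = q.2].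

(* Zorn: a maximal injection [B * B -> B], [B] an infinite subset of [A].  If
   [A \ B] were not below [B], it would contain a copy [C] of [B], and the
   injection would extend by one from [(B U C)^2] to [C]. *)
Lemma card_setXX_le A : infinite_set A -> A `*` A #<= A.
Proof.
move=> Ainf.
pose P (G : set (T * T * T)) := G = set0 \/ exists B f,
  [/\ B `<=` A, infinite_set B, square_inj B f & G = graph B f].
have graph_good (X : set (T * T * T)) q : P X -> X q -> exists B f,
    [/\ B `<=` A, infinite_set B, square_inj B f & X = graph B f].
  by move=> [->|].
have [F FP Ftot|G [GP Gmax]] := @Zorn_bigcup _ P.
  set U := \bigcup_(X in F) X.
  have [U0|[q0 Uq0]] : U = set0 \/ U !=set0.
    by have [->|/set0P] := eqVneq U set0; [left|right].
    by left.
  have common q q' : U q -> U q' -> exists B f,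
      [/\ B `<=` A, infinite_set B, square_inj B f,
          graph B f `<=` U & graph B f q /\ graph B f q'].
    move=> [X FX Xq] [X' FX' X'q'].
    have [XX'|X'X] := Ftot _ _ FX FX'.
      have [B [f [BA Bi Bf E]]] := graph_good _ _ (FP _ FX') X'q'.
      exists B, f; rewrite -E; split=> //; last by split=> //; exact: XX'.
      by move=> u ?; exists X'.
    have [B [f [BA Bi Bf E]]] := graph_good _ _ (FP _ FX) Xq.
    exists B, f; rewrite -E; split=> //; last by split=> //; exact: X'X.
    by move=> u ?; exists X.
  (* The domain is read off the diagonal, each graph of the chain being defined on a whole
     square. *)
  right; pose B := [set b | exists z, U ((b, b), z)].
  pose f p := xget point [set z | U (p, z)].
  have BU b b' : B b -> B b' -> exists z, U ((b, b'), z).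
    move=> [z Uz] [z' Uz'].
    have [C [g [_ _ _ CU [[[/= Cb _] _] [[/= Cb' _] _]]]]] := common _ _ Uz Uz'.
    by exists (g (b, b')); apply: CU; split.
  have fP p : (B `*` B) p -> U (p, f p).
    move: p => [b b'] [/= Bb Bb'].
    by rewrite /f; case: xgetP => [z -> //|nz]; have [z /nz] := BU _ _ Bb Bb'.
  have UB p z : U (p, z) -> [/\ B p.1, B p.2 & B z].
    move=> Up; have [C [g [_ _ [gC _] CU [[Cp gp] _]]]] := common _ _ Up Up.
    move: Cp gp => /= Cp gp; have Cz : C z by rewrite -gp; exact: gC.
    by case: Cp => /= C1 C2;
      split; [exists (g (p.1, p.1))|exists (g (p.2, p.2))|exists (g (z, z))];
      apply: CU; split.
  have Ufun p z z' : U (p, z) -> U (p, z') -> z = z'.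
    move=> Uz Uz'; have [C [g [_ _ _ _ [[_ /= <-] [_ /= <-]]]]] :=
      common _ _ Uz Uz'.
    by [].
  have Uinj p p' z : U (p, z) -> U (p', z) -> p = p'.
    move=> Uz Uz'; have [C [g [_ _ [_ gI] _ [[Cp /= gp] [Cp' /= gp']]]]] :=
      common _ _ Uz Uz'.
    by apply: gI => //; rewrite gp gp'.
  exists B, f; split.
  - move=> b [z Uz]; have [C [g [CA _ _ _ [[[/= Cb _] _] _]]]] :=
      common _ _ Uz Uz.
    exact: CA.
  - have [C [g [_ Ci _ CU _]]] := common _ _ Uq0 Uq0.
    by apply: sub_infinite_set Ci => c Cc; exists (g (c, c)); apply: CU; split.
  - split=> [p /fP/UB[]//|p q /fP Up /fP Uq E].
    by apply: (Uinj _ _ (f p)) => //; rewrite E.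
  - apply/seteqP; split=> [[p z] Uz|[p z] [/= Bp <-]]; last exact: fP.
    have [B1 B2 _] := UB _ _ Uz.
    have Bp : (B `*` B) p by [].
    by split=> //=; exact: Ufun (fP _ Bp) Uz.
have [B [f [BA Bi [fB fI] GE]]] : exists B f,
    [/\ B `<=` A, infinite_set B, square_inj B f & G = graph B f].
  (* The empty graph is not maximal: a countable subset of [A] admits an injection of its square. *)
  case: GP => // G0; exfalso.
  have [g gA gI] := card_le_ex ((infiniteP _).1 Ainf).
  pose B := g @` [set: nat].
  have [lB gB] : B #<= [set: nat] /\ [set: nat] #<= B.
    by apply/card_eqPle/inj_card_eq => x y _ _; exact: gI.
  have Bi : infinite_set B.
    exact/infiniteP.
  have BB : B `*` B #<= B.
    apply: card_le_trans (card_leX lB lB) _; rewrite setXTT.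
    by apply: card_le_trans gB; have /card_eqPle[] := card_nat2.
  have [f fB fI] := card_le_ex BB.
  have [b Bb] := infinite_setN0 Bi.
  apply: (Gmax (graph B f)).
    rewrite G0; split=> // /(_ ((b, b), f (b, b))) []; split=> //.
  by right; exists B, f; split=> //; move=> _ [n _ <-]; exact: gA.
have BB : B `*` B #<= B by exact: card_le_injective fB fI.
have AB : A #<= B.
  have [AB|/card_le_ex[j jC jI]] := card_le_comparable (A `\` B) B.
    by rewrite -(setDUK BA); exact: card_setU_le.
  exfalso; pose C := j @` B.
  have CB : C #<= B by exact: card_image_le.
  have BC : B #<= C by apply: (card_le_injective _ jI) => x Bx; exists x.
  have UB : B `|` C #<= B by exact: card_setU_le.
  have [k kC kI] :=
    card_le_ex (card_le_trans (card_leX UB UB) (card_le_trans BB BC)).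
  have Cn x : C x -> ~ B x by move=> [y By <-]; case: (jC _ By).
  pose f' p := if pselect ((B `*` B) p) then f p else k p.
  have f'B p : (B `*` B) p -> f' p = f p by rewrite /f'; case: pselect.
  have f'N p : ~ (B `*` B) p -> f' p = k p by rewrite /f'; case: pselect.
  have [b Bb] := infinite_setN0 Bi.
  have Cj : C (j b) by exists b.
  apply: (Gmax (graph (B `|` C) f')).
    rewrite GE; split=> [[p z] [/= [p1 p2] fp]|].
      by split=> /=; [split; left|rewrite f'B].
    move=> /(_ ((j b, j b), f' (j b, j b))) [|[/= /(Cn _ Cj)]] //.
    by split=> //=; split; right.
  right; exists (B `|` C), f'; split=> //.
  - by move=> x [/BA//|[y By <-]]; case: (jC _ By).
  - by apply: sub_infinite_set Bi => x Bx; left.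
  - split=> [p Up|p q Up Uq].
      have [Bp|nBp] := pselect ((B `*` B) p).
        by rewrite f'B//; left; exact: fB.
      by rewrite f'N//; right; exact: kC.
    have [Bp|nBp] := pselect ((B `*` B) p);
      have [Bq|nBq] := pselect ((B `*` B) q);
      rewrite ?(f'B p Bp) ?(f'B q Bq) ?(f'N p nBp) ?(f'N q nBq).
    + exact: fI.
    + by move=> E; case: (Cn (k q)); [exact: kC|rewrite -E; exact: fB].
    + by move=> E; case: (Cn (k p)); [exact: kC|rewrite E; exact: fB].
    + exact: kI.
apply: card_le_trans (card_leX AB AB) (card_le_trans BB _).
exact: subset_card_le.
Qed.
End square.

(** * Height profiles on an edge *)

(** A [min] whose right argument is a [min] is skipped at first, so that nested minima are split
    from the inside. *)
Ltac minmax_lra := repeat match goal with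
  | |- context [Order.min ?x ?y] =>
      lazymatch y with Order.min _ _ => fail | _ => case: (leP x y) => ? end
  | |- context [Order.max ?x ?y] => case: (leP x y) => ?
  end; lra.

Section profiles.
Variable R : realType.
Implicit Types x y z c t : R.

Definition tent t : R := Num.min t (1 - t).

(* Both profiles are functions of the position [c] on the edge [(x, y)], whose
   points are at distance at most [|x - y| + c] from [x] and [1 - c] from [y]. *)
Definition peak x y c z : R :=
  (z == x)%:R * Num.max 0 (tent x - (`|x - y| + c)) +
  (z == y)%:R * Num.max 0 (tent y - (1 - c)).

Definition gap x y c : R := Num.min (tent y) (Num.min (`|x - y| + c) (1 - c)).

Lemma tent_ge0 t : 0 <= t < 1 -> 0 <= tent t.
Proof. by rewrite /tent => /andP[t0 t1]; minmax_lra. Qed.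

Lemma tent_gt0 t : 0 < t < 1 -> 0 < tent t.
Proof. by rewrite /tent => /andP[t0 t1]; minmax_lra. Qed.

Lemma tent_le t : (tent t <= t) * (tent t <= 1 - t) * (tent t <= 2^-1).
Proof. by rewrite /tent; do ?split; minmax_lra. Qed.

Lemma tent0 : tent 0 = 0.
Proof. by rewrite /tent; minmax_lra. Qed.

Lemma tent_le_dist x y : tent x <= tent y + `|x - y|.
Proof.
have := ler_norm (x - y); have := ler_norm (y - x); rewrite (distrC y x).
by rewrite /tent => ? ?; minmax_lra.
Qed.

Lemma peak_ge0 x y c z : 0 <= peak x y c z.
Proof. by rewrite addr_ge0// mulr_ge0// le_max lexx. Qed.

(** For [x <> y] at most one summand survives, and [tent] is 1-Lipschitz. For [x = y] the value
    [c = 0] kills the second summand. *)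
Lemma peak_le x y c z : 0 <= x < 1 -> 0 <= y < 1 -> 0 <= c < 1 ->
  (x = y -> c = 0) -> peak x y c z <= tent y.
Proof.
move=> hx hy hc xyc; rewrite /peak.
have := tent_ge0 hy; have := tent_le_dist x y; have [[_ _]] := tent_le y.
have := normr_ge0 (x - y).
have [->|zx] := eqVneq z x; have [yx|zy] := eqVneq _ y; rewrite ?mul1r ?mul0r.
- by rewrite (xyc yx) yx subrr normr0 => *; minmax_lra.
- by move=> *; minmax_lra.
- by move=> *; minmax_lra.
- by move=> *; minmax_lra.
Qed.

Lemma peak_vertex x z : 0 <= x < 1 -> peak x x 0 z = (z == x)%:R * tent x.
Proof.
move=> hx; have := tent_ge0 hx; have [[_ _]] := tent_le x.
rewrite /peak -mulrDr subrr normr0 => ? ?; congr (_ * _); minmax_lra.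
Qed.

Lemma gap_vertex x : 0 <= x < 1 -> gap x x 0 = 0.
Proof.
move=> hx; have := tent_ge0 hx.
by rewrite /gap subrr normr0 => ?; minmax_lra.
Qed.

Lemma gap_le x y c :
  (gap x y c <= tent y) * (gap x y c <= `|x - y| + c) * (gap x y c <= 1 - c).
Proof. by rewrite /gap; do ?split; minmax_lra. Qed.

Lemma gap_ge0 x y c : 0 <= y < 1 -> 0 <= c < 1 -> 0 <= gap x y c.
Proof.
move=> hy hc; have := tent_ge0 hy; have := normr_ge0 (x - y).
by rewrite /gap => ? ?; minmax_lra.
Qed.

Lemma gap_gt0 x y c : 0 < y < 1 -> 0 <= c < 1 -> x != y -> 0 < gap x y c.
Proof.
move=> hy hc; rewrite -subr_eq0 -normr_gt0.
by have := tent_gt0 hy; rewrite /gap => ? ?; minmax_lra.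
Qed.

(** The left side is the factor that [scale] gains over two levels; hence the gap of an edge
    dominates all probes inside it, see [probe_deep]. *)
Lemma tent_mul_le_gap x y c : 0 <= y < 1 -> 0 <= c < 1 ->
  tent y * tent c <= gap x y c.
Proof.
move=> hy hc; have y0 := tent_ge0 hy; have c0 := tent_ge0 hc.
have [[_ _] y1] := tent_le y; have [[c1 c2] c3] := tent_le c.
have := normr_ge0 (x - y) => xy.
have le1 : tent y * tent c <= tent y by rewrite ler_piMr//; lra.
have le2 : tent y * tent c <= tent c by rewrite ler_piMl//; lra.
by rewrite /gap; minmax_lra.
Qed.

Lemma peak_lipschitz x y c c' z : (x = y -> c = c') ->
  `|peak x y c z - peak x y c' z| <= `|c - c'|.
Proof.
move=> xyc; have := ler_norm (c - c'); have := ler_norm (c' - c).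
rewrite (distrC c') => h1 h2; rewrite ler_norml /peak.
have [->|zx] := eqVneq z x; have [yx|zy] := eqVneq _ y; rewrite ?mul1r ?mul0r.
- by rewrite (xyc yx) !subrr normr0 oppr0 lexx.
all: by apply/andP; split; minmax_lra.
Qed.

Lemma gap_lipschitz x y c c' : `|gap x y c - gap x y c'| <= `|c - c'|.
Proof.
have := ler_norm (c - c'); have := ler_norm (c' - c).
rewrite (distrC c') => h1 h2; rewrite ler_norml /gap.
by apply/andP; split; minmax_lra.
Qed.

(** By [peak_vertex], [(z == t)%:R * tent t] is the profile of the vertex [t]. A point of the edge
    is compared here with its left end, in [peak_near_right] with its right end. *)
Lemma peak_near_left x y c z : 0 <= x < 1 -> 0 <= y < 1 -> 0 <= c < 1 ->
  `|peak x y c z - (z == x)%:R * tent x| <= `|x - y| + c.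
Proof.
move=> hx hy hc; have := tent_ge0 hx; have := tent_ge0 hy.
have [[_ _]] := tent_le y; have [[_ _]] := tent_le x.
have := normr_ge0 (x - y).
rewrite ler_norml /peak.
have [->|zx] := eqVneq z x; have [yx|zy] := eqVneq _ y; rewrite ?mul1r ?mul0r;
  by move=> *; apply/andP; split; minmax_lra.
Qed.

Lemma peak_near_right x y c z : 0 <= x < 1 -> 0 <= y < 1 -> 0 <= c < 1 ->
  x != y -> `|peak x y c z - (z == y)%:R * tent y| <= 1 - c.
Proof.
move=> hx hy hc xy; have := tent_ge0 hx; have := tent_ge0 hy.
have [[_ _]] := tent_le y; have [[_ _]] := tent_le x.
have := normr_ge0 (x - y).
rewrite ler_norml /peak.
have [->|zx] := eqVneq z x; have [yx|zy] := eqVneq _ y; rewrite ?mul1r ?mul0r.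
- by rewrite yx eqxx in xy.
all: by move=> *; apply/andP; split; minmax_lra.
Qed.

End profiles.

(** * Addresses and their distance *)

Section codes.
Variable R : realType.
Implicit Types (a b w : nat -> R * R) (n m k : nat) (o : option R).

(* The address of a point lists the edges entered, [(x, y)] with [x <> y]; a
   vertex [t] is encoded as the label [(t, t)] followed by labels [(0, 0)].
   Since [(a n.+1).2] is then [0] for a vertex, [(a n).2] is the position in the
   [n]-th copy in all cases. *)
Definition valid a := forall n,
  (a n = (0, 0) \/ (0 < (a n).1 < 1 /\ 0 < (a n).2 < 1)) /\
  ((a n).1 = (a n).2 -> a n.+1 = (0, 0)).

Definition agree n a b := forall m, (m < n)%N -> a m = b m.

(* The first [n] labels are all edges (label [n - 1] suffices, by [valid]), so
   they address a copy rather than a point. *)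
Definition live n a := forall k, n = k.+1 -> (a k).1 <> (a k).2.

(** For [l = (t, t)] this is the vertex [t] of the copy reached by the first [n] labels; for
    [l = (x, y)] with [x <> y], the vertex 0 of its edge [(x, y)]. *)
Definition put n a (l : R * R) : nat -> R * R :=
  fun m => if (m < n)%N then a m else if m == n then l else (0, 0).

Definition scale a n : R := \prod_(m < n) tent (a m).2.

(* [probe n w (Some z)] peaks at the vertex [z] of the copy at address [w] of
   depth [n]; [probe n w None] is supported on the edge [w n] of that copy.  The
   factor [scale] makes every probe of depth [> n] bounded by the one of the
   edge of depth [n] containing its support. *)
Definition probe n w o a : R :=
  if o is Some z then
    if `[< agree n w a >]
    then scale a n * peak (a n).1 (a n).2 (a n.+1).2 z else 0
  else
    if `[< agree n.+1 w a >]
    then scale a n * gap (a n).1 (a n).2 (a n.+1).2 else 0.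

(** As a sup distance between families of probes it inherits symmetry and the triangle inequality
    from the reals. Probes of valid addresses lie in [0, 1], so the set is bounded. *)
Definition cdist a b : R :=
  sup [set r | exists n w o, r = `|probe n w o a - probe n w o b|]%classic.

Lemma agree_refl n a : agree n a a. Proof. by []. Qed.

Lemma agree_sym n a b : agree n a b -> agree n b a.
Proof. by move=> ab m mn; rewrite ab. Qed.

Lemma agree_trans n b a c : agree n a b -> agree n b c -> agree n a c.
Proof. by move=> ab bc m mn; rewrite ab// bc. Qed.

Lemma agree_le n m a b : (n <= m)%N -> agree m a b -> agree n a b.
Proof. by move=> nm ab k kn; apply: ab; exact: leq_trans nm. Qed.

Lemma agreeS n a b : agree n a b -> a n = b n -> agree n.+1 a b.
Proof.
by move=> ab abn m; rewrite ltnS leq_eqVlt => /predU1P[->//|]; exact: ab.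
Qed.

Lemma agree_neq a b : a <> b -> exists n, agree n a b /\ a n != b n.
Proof.
move=> ab; have ex : exists n, a n != b n.
  apply: contrapT => nex; apply: ab; apply/funext => n.
  by apply/eqP; apply: contrapT => /negP abn; apply: nex; exists n.
case: (ex_minnP ex) => n abn nmin; exists n; split=> // m mn.
by apply/eqP; apply: contraTT mn => /nmin; rewrite -leqNgt.
Qed.

Lemma agree_scale n a b : agree n a b -> scale a n = scale b n.
Proof. by move=> ab; apply: eq_bigr => i _; rewrite ab. Qed.

Lemma putE_lt n a l m : (m < n)%N -> put n a l m = a m.
Proof. by rewrite /put => ->. Qed.

Lemma putE_eq n a l : put n a l n = l.
Proof. by rewrite /put ltnn eqxx. Qed.

Lemma putE_gt n a l m : (n < m)%N -> put n a l m = (0, 0).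
Proof. by move=> nm; rewrite /put ltnNge (ltnW nm)/= gtn_eqF. Qed.

Lemma agree_put n a l : agree n a (put n a l).
Proof. by move=> m mn; rewrite putE_lt. Qed.

Lemma put_agree n a b l : agree n a b -> put n a l = put n b l.
Proof. by move=> ab; apply/funext => m; rewrite /put; case: ltnP => // /ab. Qed.

Section one_code.
Variables (a : nat -> R * R) (va : valid a).

Lemma valid_fst n : 0 <= (a n).1 < 1.
Proof. by case: (va n) => -[->|[]] /=; lra. Qed.

Lemma valid_snd n : 0 <= (a n).2 < 1.
Proof. by case: (va n) => -[->|[]] /=; lra. Qed.

Lemma valid_eq n : (a n).1 = (a n).2 -> (a n.+1).2 = 0.
Proof. by case: (va n) => _ h /h ->. Qed.

Lemma valid_dead n m : (a n).1 = (a n).2 -> (n < m)%N -> a m = (0, 0).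
Proof.
move=> an; elim: m => // m IH; rewrite ltnS leq_eqVlt => /predU1P[<-|/IH am].
  by case: (va n) => _; exact.
by case: (va m) => _; apply; rewrite am.
Qed.

Lemma valid_live n m : (m <= n)%N -> a n != (0, 0) -> live m a.
Proof.
by move=> mn an k mk /valid_dead h; rewrite h ?eqxx// -mk in an.
Qed.

Lemma valid_ne n : a n != (0, 0) -> 0 < (a n).1 < 1 /\ 0 < (a n).2 < 1.
Proof. by case: (va n) => -[->|//]; rewrite eqxx. Qed.

Lemma valid_neq n : (a n).1 != (a n).2 -> a n != (0, 0).
Proof. by apply: contra_neq => ->. Qed.

Lemma scale_gt0 n : (forall m, (m < n)%N -> a m != (0, 0)) -> 0 < scale a n.
Proof.
move=> an; apply: prodr_gt0 => -[k kn] _ /=; apply: tent_gt0.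
by have [] := valid_ne (an k kn).
Qed.

Lemma live_scale_gt0 n : live n a -> 0 < scale a n.
Proof.
case: n => [|n] na; first by rewrite /scale big_ord0.
apply: scale_gt0 => m; rewrite ltnS => mn; apply/eqP => am.
apply: (na n erefl); move: mn; rewrite leq_eqVlt => /predU1P[<-|mn].
  by rewrite am.
by rewrite (@valid_dead m) ?am.
Qed.

Lemma scale_ge0 n : 0 <= scale a n.
Proof. by apply: prodr_ge0 => k _; apply: tent_ge0; exact: valid_snd. Qed.

Lemma scaleS n : scale a n.+1 = scale a n * tent (a n).2.
Proof. by rewrite /scale big_ord_recr. Qed.

Lemma scale_le n m : (n <= m)%N -> scale a m <= scale a n.
Proof.
elim: m => [|m IH]; first by rewrite leqn0 => /eqP ->.
rewrite leq_eqVlt => /predU1P[->//|/IH]; apply: le_trans.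
rewrite scaleS ler_piMr ?scale_ge0//.
by have [[_ _]] := tent_le (a m).2; lra.
Qed.

Lemma scale_le_exp n : scale a n <= 2^-1 ^+ n.
Proof.
elim: n => [|n IH]; first by rewrite /scale big_ord0 expr0.
rewrite scaleS exprSr ler_pM ?scale_ge0 ?tent_ge0 ?valid_snd//.
by have [[_ _]] := tent_le (a n).2.
Qed.

Lemma scale_le1 n : scale a n <= 1.
Proof. by apply: le_trans (scale_le (leq0n n)) _; rewrite /scale big_ord0. Qed.

Lemma probe_ge0 n w o : 0 <= probe n w o a.
Proof.
rewrite /probe; case: o => [z|]; case: asboolP => // _;
  rewrite mulr_ge0 ?scale_ge0 ?peak_ge0 ?gap_ge0 ?valid_snd//.
Qed.

Lemma probe_le_scale n w o : probe n w o a <= scale a n.+1.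
Proof.
rewrite /probe; case: o => [z|]; case: asboolP => _; rewrite ?scale_ge0//.
all: rewrite scaleS ler_wpM2l ?scale_ge0//.
  by apply: peak_le; rewrite ?valid_snd ?valid_fst//; exact: valid_eq.
by rewrite gap_le.
Qed.

Lemma probe_deep n m w o : (n < m)%N ->
  probe m w o a <= scale a n * gap (a n).1 (a n).2 (a n.+1).2.
Proof.
move=> nm; apply: le_trans (probe_le_scale _ _ _) _.
have nm2 : (n.+2 <= m.+1)%N by [].
apply: le_trans (scale_le nm2) _.
rewrite !scaleS -mulrA ler_wpM2l ?scale_ge0//.
by apply: tent_mul_le_gap; exact: valid_snd.
Qed.

Lemma valid_put n x y : live n a -> 0 < x < 1 -> 0 < y < 1 ->
  valid (put n a (x, y)).
Proof.
move=> na hx hy k; have [kn|nk] := ltnP k n.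
  rewrite putE_lt//; split=> [|ak]; first by case: (va k).
  have [kn1|] := ltnP k.+1 n; first by rewrite putE_lt//; case: (va k) => _; exact.
  by move=> nk; case: (na k) => //; apply/eqP; rewrite eqn_leq nk kn.
split; last by move=> _; rewrite putE_gt.
move: nk; rewrite leq_eqVlt => /predU1P[<-|nk]; rewrite ?putE_eq; first by right.
by left; rewrite putE_gt.
Qed.

Lemma valid_trunc n : valid (put n a (0, 0)).
Proof.
move=> k; have [kn|nk] := ltnP k n; last first.
  split; last by move=> _; rewrite putE_gt.
  by left; rewrite /put ltnNge nk; case: eqP.
rewrite putE_lt//; split=> [|ak]; first by case: (va k).
have [kn1|nk] := ltnP k.+1 n; first by rewrite putE_lt//; case: (va k) => _; exact.
have <- : n = k.+1 by apply/eqP; rewrite eqn_leq nk kn.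
by rewrite putE_eq.
Qed.

End one_code.

Lemma probe_agree n m w o a b : (m.+1 < n)%N -> agree n a b ->
  probe m w o a = probe m w o b.
Proof.
move=> mn ab; have mn' := ltnW mn.
have ag k : (k <= n)%N -> `[< agree k w a >] = `[< agree k w b >].
  move=> kn; apply: asbool_equiv_eq; have abk := agree_le kn ab.
  by split=> h; [exact: agree_trans abk|exact: agree_trans (agree_sym abk)].
rewrite /probe !ag// ?(ltnW mn')// (agree_scale (agree_le (ltnW mn') ab)).
by rewrite !ab.
Qed.

Lemma cdist_le a b (M : R) :
  (forall n w o, `|probe n w o a - probe n w o b| <= M) -> cdist a b <= M.
Proof.
move=> abM; apply: ge_sup.
  by exists `|probe 0 a None a - probe 0 a None b|, 0%N, a, None.
by move=> _ [n [w [o ->]]]; exact: abM.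
Qed.

Lemma ler_dist_max (u v M : R) : 0 <= u -> 0 <= v -> u <= M -> v <= M ->
  `|u - v| <= M.
Proof. by move=> *; rewrite ler_norml; apply/andP; split; lra. Qed.

Section two_codes.
Variables (a b : nat -> R * R) (va : valid a) (vb : valid b).

Lemma probe_le_cdist n w o : `|probe n w o a - probe n w o b| <= cdist a b.
Proof.
apply: ub_le_sup; last by exists n, w, o.
exists 1 => _ [m [u [p ->]]].
by apply: ler_dist_max; rewrite ?probe_ge0//;
  apply: le_trans (probe_le_scale _ _ _ _) _ => //; exact: scale_le1.
Qed.

(** Probes of depth below [n - 1] read only common labels. Those of depth [n - 1] see only the
    positions [(a n).2] and [(b n).2], on which both profiles depend in a 1-Lipschitz way. The last
    two hypotheses cover the other depths. *)
Lemma cdist_close n (M : R) : agree n a b ->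
  (forall k, n = k.+1 -> `|(a n).2 - (b n).2| <= M) ->
  (forall w o, `|probe n w o a - probe n w o b| <= M) ->
  (forall m w o, (n < m)%N -> probe m w o a <= M /\ probe m w o b <= M) ->
  cdist a b <= M.
Proof.
move=> ab abM probeM deepM.
have M0 : 0 <= M := le_trans (normr_ge0 _) (probeM a None).
apply: cdist_le => m w o.
have [mn|nm|mn] := ltngtP m n; first last.
- by rewrite mn.
- by have [? ?] := deepM _ w o nm; apply: ler_dist_max; rewrite ?probe_ge0.
have [mn1|nm] := ltnP m.+1 n; first by rewrite (probe_agree _ _ mn1 ab) subrr normr0.
have nE : n = m.+1 by apply/eqP; rewrite eqn_leq nm mn.
have ag k : (k <= n)%N -> `[< agree k w a >] = `[< agree k w b >].
  move=> kn; apply: asbool_equiv_eq; have abk := agree_le kn ab.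
  by split=> h; [exact: agree_trans abk|exact: agree_trans (agree_sym abk)].
have lip (u v : R) : `|u - v| <= `|(a n).2 - (b n).2| ->
    `|scale b m * u - scale b m * v| <= M.
  move=> uv; rewrite -mulrBr normrM ger0_norm ?scale_ge0//.
  apply: le_trans (le_trans uv (abM _ nE)).
  by rewrite ler_piMl// scale_le1.
rewrite /probe !ag//; last exact: ltnW.
rewrite (agree_scale (agree_le (ltnW mn) ab)) (ab _ mn) -nE.
case: o => [z|]; case: asboolP => _; rewrite ?subrr ?normr0//; apply: lip.
  apply: peak_lipschitz => bm; rewrite nE (valid_eq vb)// (valid_eq va)//.
  by rewrite ab.
exact: gap_lipschitz.
Qed.

(** A probe that tells [a] from [b] has depth at least [n - 1], so it is bounded by a product of at
    least [n] tents, each at most 1/2. *)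
Lemma cdist_agree n : agree n a b -> cdist a b <= 2^-1 ^+ n.
Proof.
move=> ab; apply: cdist_le => m w o.
have [mn1|nm] := ltnP m.+1 n.
  by rewrite (probe_agree _ _ mn1 ab) subrr normr0 exprn_ge0// invr_ge0.
have exp_le : 2^-1 ^+ m.+1 <= 2^-1 ^+ n :> R.
  by rewrite ler_wiXn2l// ?invr_ge0// invf_le1// ler1n.
apply: ler_dist_max; rewrite ?probe_ge0//.
  apply: le_trans (probe_le_scale va _ _ _) _.
  exact: le_trans (scale_le_exp va _) exp_le.
apply: le_trans (probe_le_scale vb _ _ _) _.
exact: le_trans (scale_le_exp vb _) exp_le.
Qed.

End two_codes.

Lemma cdistxx a : cdist a a = 0.
Proof.
apply/eqP; rewrite eq_le; apply/andP; split.
  by apply: cdist_le => n w o; rewrite subrr normr0.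
apply: ub_le_sup; last by exists 0%N, a, None; rewrite subrr normr0.
by exists 0 => _ [m [u [p ->]]]; rewrite subrr normr0.
Qed.

Lemma cdistC a b : cdist a b = cdist b a.
Proof.
by rewrite /cdist; congr sup; apply/seteqP; split=> r [n [w [o ->]]];
  exists n, w, o; rewrite distrC.
Qed.

Lemma cdist_triangle b a c : valid a -> valid b -> valid c ->
  cdist a c <= cdist a b + cdist b c.
Proof.
move=> va vb vc; apply: cdist_le => n w o.
by apply: le_trans (ler_distD (probe n w o b) _ _) _; rewrite lerD ?probe_le_cdist.
Qed.

Section separation.
Variables (a b : nat -> R * R) (va : valid a) (vb : valid b).

(* If [a n] is an edge label, only the codes sharing it see the probe
   [(n, a, None)]. *)
Lemma gap_le_cdist n : a n != b n ->
  scale a n * gap (a n).1 (a n).2 (a n.+1).2 <= cdist a b.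
Proof.
move=> abn; apply: le_trans (probe_le_cdist va vb n a None).
rewrite /probe (asboolT (@agree_refl n.+1 a)); case: asboolP => [ab|_].
  by move: abn; rewrite (ab n)// eqxx.
by rewrite subr0 ler_norm.
Qed.

End separation.

(** An edge label is detected by its gap probe. If both labels are vertices, the peak probe of the
    vertex [(a n).1] separates them; its height is positive because this vertex is not 0. *)
Lemma cdist_eq0_dir a b n : valid a -> valid b -> agree n a b -> a n != b n ->
  (a n).1 != 0 -> 0 < cdist a b.
Proof.
move=> va vb ab abn an; have an0 : a n != (0, 0) by apply: contra_neq an => ->.
have [a1 a2] := valid_ne va an0.
have S0 := live_scale_gt0 va (valid_live va (leqnn n) an0).
have [axy|axy] := eqVneq (a n).1 (a n).2; last first.
  apply: lt_le_trans (gap_le_cdist va vb abn); rewrite mulr_gt0//.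
  exact: gap_gt0 (valid_snd va _) _.
have [bxy|bxy] := eqVneq (b n).1 (b n).2; last first.
  have ban : b n != a n by rewrite eq_sym.
  rewrite cdistC; apply: lt_le_trans (gap_le_cdist vb va ban).
  have [b1 b2] := valid_ne vb (valid_neq bxy).
  rewrite mulr_gt0 -?(agree_scale ab)//.
  exact: gap_gt0 (valid_snd vb _) _.
apply: lt_le_trans (probe_le_cdist va vb n a (Some (a n).1)).
rewrite /probe (asboolT (@agree_refl n a)) (asboolT ab).
rewrite (valid_eq va)// (valid_eq vb)// -axy -bxy !peak_vertex ?valid_fst//.
rewrite eqxx mul1r (_ : ((a n).1 == (b n).1) = false) ?mul0r ?mulr0 ?subr0.
  by rewrite normr_gt0 mulf_neq0// gt_eqF// tent_gt0.
apply: contra_neqF abn => /eqP E.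
by rewrite (surjective_pairing (a n)) (surjective_pairing (b n)) -axy -bxy E.
Qed.

Lemma cdist_eq0 a b : valid a -> valid b -> cdist a b = 0 -> a = b.
Proof.
move=> va vb ab0; apply: contrapT => /agree_neq[n [ab abn]].
have [an|an] := eqVneq (a n).1 0; last first.
  by have := cdist_eq0_dir va vb ab abn an; rewrite ab0 ltxx.
have [bn|bn] := eqVneq (b n).1 0; last first.
  have := cdist_eq0_dir vb va (agree_sym ab) _ bn.
  by rewrite cdistC ab0 ltxx eq_sym abn => /(_ isT).
(* By validity a label with first component 0 is [(0, 0)], so two different labels cannot both start
   with 0. *)
move: abn; have [-> | [+ _]] := (va n).1; last by rewrite an ltxx.
by have [-> | [+ _]] := (vb n).1; rewrite ?eqxx// bn ltxx.
Qed.

End codes.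

(** * Locality of the distance, and estimates near vertices *)

Section estimates.
Variable R : realType.
Implicit Types (a b w : nat -> R * R) (n m k : nat) (o : option R).

Lemma probe_out n m w o a : (n < m)%N -> ~ agree n.+1 w a -> probe m w o a = 0.
Proof.
move=> nm nwa; rewrite /probe; case: o => [z|]; case: asboolP => // wa;
  by case: nwa; apply: agree_le wa; rewrite ?ltnS// ltnW.
Qed.

(** A probe of depth above [n] lives inside one edge of depth [n], so it vanishes at [a] or at [b].
    At the other point it is at most the gap of that point's edge, which [gap_le_cdist] bounds by
    the distance of [a'] and [b']. *)
Lemma cdist_local n a b a' b' : valid a -> valid b -> valid a' -> valid b' ->
  agree n a b -> a n != b n -> agree n.+2 a a' -> agree n.+2 b b' ->
  cdist a b <= cdist a' b'.
Proof.
move=> va vb va' vb' ab abn aa' bb'; apply: cdist_le => m w o.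
have [mn|nm] := leqP m n.
  have mn2 : (m.+1 < n.+2)%N by [].
  by rewrite (probe_agree _ _ mn2 aa') (probe_agree _ _ mn2 bb') probe_le_cdist.
have abn' : a' n != b' n by rewrite -aa'// -bb'.
have bound c c' : valid c -> agree n.+2 c c' ->
    probe m w o c <= scale c' n * gap (c' n).1 (c' n).2 (c' n.+1).2.
  move=> vc cc'; apply: le_trans (probe_deep vc _ _ nm) _.
  by rewrite (agree_scale (agree_le _ cc')) ?cc'//; apply: leq_trans (leqnSn _).
have [wb|wb] := pselect (agree n.+1 w b); last first.
  rewrite (probe_out _ nm wb) subr0 ger0_norm ?probe_ge0//.
  exact: le_trans (bound _ _ va aa') (gap_le_cdist va' vb' abn').
have wa : ~ agree n.+1 w a.
  by move=> wa; move: abn; rewrite -wa// -wb// eqxx.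
rewrite (probe_out _ nm wa) sub0r normrN ger0_norm ?probe_ge0// cdistC.
by apply: le_trans (bound _ _ vb bb') (gap_le_cdist vb' va' _); rewrite eq_sym.
Qed.

Lemma cdist_local_eq n a b a' b' : valid a -> valid b -> valid a' -> valid b' ->
  agree n a b -> a n != b n -> agree n.+2 a a' -> agree n.+2 b b' ->
  cdist a b = cdist a' b'.
Proof.
move=> va vb va' vb' ab abn aa' bb'; apply/eqP; rewrite eq_le.
rewrite (cdist_local va vb va' vb' ab abn aa' bb').
apply: (@cdist_local n) => //; try exact: agree_sym.
  by move=> m mn; rewrite -aa' -?bb' ?ab// ltnW// ltnW.
by rewrite -aa'// -bb'.
Qed.

Section one_code.
Variables (a : nat -> R * R) (va : valid a).

Lemma scaleS_le_tent n : scale a n.+1 <= tent (a n).2.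
Proof. by rewrite scaleS ler_piMl ?scale_le1// tent_ge0// valid_snd. Qed.

(** Probes of depth at least [n] vanish at the truncation and are at most [tent (a n).2] at [a];
    those of depth [n - 1] see the position move from [(a n).2] to 0. *)
Lemma cdist_trunc n (M : R) : tent (a n).2 <= M ->
  (forall k, n = k.+1 -> (a n).2 <= M) -> cdist a (put n a (0, 0)) <= M.
Proof.
move=> tM nM; have vb := valid_trunc va n.
have M0 : 0 <= M by apply: le_trans tM; rewrite tent_ge0// valid_snd.
have aM m w o : (n <= m)%N -> probe m w o a <= M.
  move=> nm; apply: le_trans (probe_le_scale va _ _ _) _.
  exact: le_trans (scale_le va (nm : (n.+1 <= m.+1)%N)) (le_trans (scaleS_le_tent _) tM).
have bM m w o : (n <= m)%N -> probe m w o (put n a (0, 0)) <= M.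
  move=> nm; apply: le_trans (probe_le_scale vb _ _ _) _.
  apply: le_trans (scale_le vb (nm : (n.+1 <= m.+1)%N)) _.
  by rewrite scaleS putE_eq tent0 mulr0.
apply: (cdist_close va vb (@agree_put _ n a _)) => [k nk|w o|m w o nm].
- by rewrite putE_eq subr0 ger0_norm ?(nM k)//; case/andP: (valid_snd va n).
- by apply: ler_dist_max; rewrite ?probe_ge0 ?aM ?bM.
- by split; [apply: aM|apply: bM]; exact: ltnW.
Qed.

(** At a vertex of depth [n] the gap probes of depth [n] and all deeper probes vanish, so only the
    position, the peaks and the gap of [a] need control. *)
Lemma cdist_vertex n t (M : R) : valid (put n a (t, t)) -> 0 <= t < 1 ->
  `|(a n).2 - t| <= M ->
  (forall z, `|peak (a n).1 (a n).2 (a n.+1).2 z - (z == t)%:R * tent t| <= M) ->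
  gap (a n).1 (a n).2 (a n.+1).2 <= M -> cdist a (put n a (t, t)) <= M.
Proof.
set b := put n a (t, t) => vb ht atM peakM gapM.
have M0 : 0 <= M := le_trans (normr_ge0 _) atM.
have bn : b n = (t, t) by rewrite /b putE_eq.
have bn1 : b n.+1 = (0, 0) by rewrite /b putE_gt.
have g0 : 0 <= gap (a n).1 (a n).2 (a n.+1).2 by apply: gap_ge0; exact: valid_snd.
have sgM : scale a n * gap (a n).1 (a n).2 (a n.+1).2 <= M.
  by apply: le_trans gapM; rewrite ler_piMl// scale_le1.
have ab : agree n a b := @agree_put _ n a _.
apply: (cdist_close va vb ab) => [k nk|w o|m w o nm].
- by rewrite bn.
- have bNone : probe n w None b = 0.
    by rewrite /probe bn bn1 /= gap_vertex// mulr0; case: asboolP.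
  have aNone : probe n w None a <= M by rewrite /probe; case: asboolP.
  case: o => [z|]; last by apply: ler_dist_max; rewrite ?probe_ge0 ?bNone.
  rewrite /probe bn bn1 peak_vertex// -(agree_scale ab).
  have -> : `[< agree n w b >] = `[< agree n w a >].
    apply: asbool_equiv_eq; split=> h; last exact: agree_trans ab.
    exact: agree_trans (agree_sym ab).
  case: asboolP => _; last by rewrite subrr normr0.
  rewrite -mulrBr normrM ger0_norm ?scale_ge0//.
  by apply: le_trans (peakM z); rewrite ler_piMl// scale_le1.
- split; first exact: le_trans (probe_deep va _ _ nm) sgM.
  apply: le_trans (probe_deep vb _ _ nm) _.
  by rewrite bn bn1 gap_vertex// mulr0.
Qed.

Lemma valid_left n : valid (put n a ((a n).1, (a n).1)).
Proof.
have [->|an] := eqVneq (a n) (0, 0); first exact: valid_trunc.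
have [a1 a2] := valid_ne va an.
by apply: valid_put => //; exact: (valid_live va (leqnn n)).
Qed.

Lemma valid_right n : valid (put n a ((a n).2, (a n).2)).
Proof.
have [->|an] := eqVneq (a n) (0, 0); first exact: valid_trunc.
have [a1 a2] := valid_ne va an.
by apply: valid_put => //; exact: (valid_live va (leqnn n)).
Qed.

Lemma cdist_left n : cdist a (put n a ((a n).1, (a n).1)) <=
  `|(a n).1 - (a n).2| + (a n.+1).2.
Proof.
have /andP[c0 c1] := valid_snd va n.+1.
apply: cdist_vertex => [||| z|]; rewrite ?valid_fst//.
- exact: valid_left.
- by rewrite distrC lerDl.
- by apply: peak_near_left; rewrite ?valid_fst ?valid_snd.
- by rewrite gap_le.
Qed.

Lemma cdist_right n : (a n).1 != (a n).2 ->
  cdist a (put n a ((a n).2, (a n).2)) <= 1 - (a n.+1).2.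
Proof.
move=> axy; have /andP[c0 c1] := valid_snd va n.+1.
apply: cdist_vertex => [||| z|]; rewrite ?valid_snd//.
- exact: valid_right.
- by rewrite subrr normr0; lra.
- by apply: peak_near_right; rewrite ?valid_fst ?valid_snd.
- by rewrite gap_le.
Qed.

End one_code.
End estimates.

(** * Completeness *)

Definition cobweb (R : realType) : Type := {a : nat -> R * R | valid a}.

Section cobweb_metric.
Variable R : realType.
Implicit Types u v : cobweb R.

HB.instance Definition _ := gen_eqMixin (cobweb R).
HB.instance Definition _ := gen_choiceMixin (cobweb R).

Let dist u v := cdist (sval u) (sval v).

Let distxx u : dist u u = 0. Proof. exact: cdistxx. Qed.

Let dist_eq0 u v : dist u v = 0 -> u = v.
Proof.
by case: u v => [a va] [b vb] /(cdist_eq0 va vb) ab; exact: eq_exist.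
Qed.

Let distC u v : dist u v = dist v u. Proof. exact: cdistC. Qed.

Let dist_triangle v u w : dist u w <= dist u v + dist v w.
Proof. by apply: cdist_triangle; exact: svalP. Qed.

HB.instance Definition _ :=
  isMetric.Build R (cobweb R) distxx dist_eq0 distC dist_triangle.

Lemma cobweb_mdistE u v : mdist u v = cdist (sval u) (sval v).
Proof. by []. Qed.

Lemma valid0 : valid (fun=> (0, 0) : R * R).
Proof. by move=> n; split=> //; left. Qed.

HB.instance Definition _ := isPointed.Build (cobweb R) (exist _ _ valid0).

End cobweb_metric.

Lemma exp_half_lt (R : realType) (e : R) : 0 < e -> exists n, 2^-1 ^+ n < e.
Proof.
move=> e0; exists (Num.bound e^-1).
rewrite exprVn invf_plt ?posrE ?exprn_gt0//.
apply: lt_trans (archi_boundP _) _; first by rewrite invr_ge0 ltW.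
by rewrite -natrX ltr_nat ltn_expl.
Qed.

Section completeness.
Variables (R : realType) (F : set_system (cobweb R)).
Context {FF : ProperFilter F}.
Hypothesis Fcauchy : forall e : R, 0 < e -> exists2 B, F B &
  forall u v, B u -> B v -> cdist (sval u) (sval v) < e.

(** For a Cauchy filter such a point is a limit, so it suffices to find one. *)
Let cluster_at (p : cobweb R) := forall e : R, 0 < e -> forall B, F B ->
  exists2 u, B u & cdist (sval u) (sval p) < e.

Let K n (a : nat -> R * R) : set (cobweb R) := [set u | agree n a (sval u)].

(** The cylinders in [F] are compatible, since any two members of [F] meet; together they spell the
    address of the cluster point. *)
Lemma cluster_branch :
  (forall n, exists v : cobweb R, F (K n (sval v))) -> exists p, cluster_at p.
Proof.
move=> /choice[v Fv].
pose a m := sval (v m.+1) m.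
have va n : agree n (sval (v n)) a.
  move=> m mn; have [u [un um]] := filter_ex (filterI (Fv n) (Fv m.+1)).
  by rewrite un// /a um.
have a_valid : valid a.
  by move=> n; rewrite -!(va n.+2)//; exact: (svalP (v n.+2)).
exists (exist _ a a_valid) => e e0 B FB.
have [n ne] := exp_half_lt e0.
have [u [Bu un]] := filter_ex (filterI FB (Fv n)).
exists u => //; apply: le_lt_trans ne.
apply: cdist_agree => //; first exact: svalP.
exact: agree_trans (agree_sym un) (va n).
Qed.

(** * Cauchy filters whose deepest cylinder has depth [n] *)

Section last_word.
Variables (n : nat) (a : nat -> R * R).
Hypothesis (va : valid a) (FK : F (K n a)).
Hypothesis nFK : forall v : cobweb R, ~ F (K n.+1 (sval v)).

Let gapn (u : cobweb R) := gap (sval u n).1 (sval u n).2 (sval u n.+1).2.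

(** After a vertex label all labels are forced, so a cylinder of depth [n.+1] would belong to [F]
    too. *)
Lemma last_word_live : live n a.
Proof.
move=> k nk ak; apply: (@nFK (exist _ a va)) => /=.
apply: filterS FK => u un; apply: agreeS => //.
have kn : (k < n)%N by rewrite nk.
by rewrite (valid_dead va ak kn) (valid_dead (svalP u) _ kn)// -un.
Qed.

(** If a point [u] of a small member had a gap of at least [e], then by [gap_le_cdist] the nearby
    points would share its label [n], and [F] would contain a deeper cylinder. *)
Lemma last_word_gap (e : R) : 0 < e -> F [set u | K n a u /\ gapn u < e].
Proof.
move=> e0; have S0 := live_scale_gt0 va last_word_live.
have [B FB Be] := Fcauchy (mulr_gt0 S0 e0).
apply: filterS (filterI FB FK) => u [Bu un]; split=> //.
rewrite ltNge; apply/negP => eu; apply: (@nFK u).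
apply: filterS (filterI FB FK) => v [Bv vn].
apply: agreeS; first exact: agree_trans (agree_sym un) vn.
apply/eqP; apply: contraT => uv.
have := le_lt_trans (gap_le_cdist (svalP u) (svalP v) uv) (Be _ _ Bu Bv).
by rewrite -(agree_scale un) ltr_pM2l// ltNge eu.
Qed.

(** If the positions [(sval u n).2] come close to 0, the vertex 0 of the copy is a cluster point.
    Otherwise they come close to 1, and the cluster point is the vertex where the enclosing edge
    ends; for [n = 0] there is no enclosing edge, and small tents suffice for the vertex 0. *)
Lemma cluster_ends : (forall e, 0 < e -> forall B, F B ->
    exists2 u, B u & tent (sval u n).2 < e) -> exists p, cluster_at p.
Proof.
move=> tent_small.
have trunc_cluster : (forall e, 0 < e -> forall B, F B -> exists2 u, B u &
    tent (sval u n).2 < e /\ forall k, n = k.+1 -> (sval u n).2 < e) ->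
    exists p, cluster_at p.
  move=> small; exists (exist _ _ (valid_trunc va n)) => e e0 B FB /=.
  have e20 : 0 < e / 2 by rewrite divr_gt0.
  have [u [Bu un] [tu yu]] := small _ e20 _ (filterI FB FK).
  exists u => //; rewrite (put_agree _ un).
  apply: (@le_lt_trans _ _ (e / 2)); last by lra.
  by apply: cdist_trunc; [exact: svalP|exact: ltW|move=> k /yu /ltW].
have [small|large] := pselect (forall e, 0 < e -> forall B, F B ->
    exists2 u, B u & (sval u n).2 < e).
  apply: trunc_cluster => e e0 B FB; have [u Bu ue] := small _ e0 _ FB.
  exists u => //; split=> //; apply: le_lt_trans ue.
  by rewrite tent_le.
have [e1 [e10 [B1 [FB1 B1e]]]] : exists e1, 0 < e1 /\ exists B1, F B1 /\
    forall u, B1 u -> e1 <= (sval u n).2.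
  apply: contrapT => nlarge; apply: large => e e0 B FB.
  apply: contrapT => nB; apply: nlarge; exists e; split=> //; exists B.
  by split=> // u Bu; rewrite leNgt; apply/negP => ue; apply: nB; exists u.
case nE : n => [|k].
  apply: trunc_cluster => e e0 B FB; have [u Bu ue] := tent_small _ e0 _ FB.
  by exists u => //; split=> //; rewrite nE.
have kn : (k < n)%N by rewrite nE.
exists (exist _ _ (valid_right va k)) => e e0 B FB /=.
have e20 : 0 < Num.min e e1 by rewrite lt_min e0.
have [u [[Bu un] /B1e u1] ] := tent_small _ e20 _ (filterI (filterI FB FK) FB1).
rewrite lt_min => /andP[ue ue1].
exists u => //; rewrite (un k)// (put_agree _ (agree_le (ltnW kn) un)).
apply: le_lt_trans (cdist_right (svalP u) _) _.
  by apply/eqP; rewrite -un//; exact: last_word_live.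
(* As the position is at least [e1], a tent below [e1] can only be 1 minus the position. *)
rewrite -nE; move: ue ue1; rewrite /tent; minmax_lra.
Qed.

Let at_vertex (u : cobweb R) z (e : R) :=
  (z = (sval u n).1 /\ `|(sval u n).1 - (sval u n).2| + (sval u n.+1).2 < e) \/
  [/\ z = (sval u n).2, (sval u n).1 != (sval u n).2 & 1 - (sval u n.+1).2 < e].

(** The gap is the minimum of the tent and the bounds for the two ends of the edge; if the tent is
    large, one end is near. *)
Let at_vertex_ex (u : cobweb R) e : gapn u < e -> e <= tent (sval u n).2 ->
  exists z, at_vertex u z e.
Proof.
move=> ue eu; have [xy|xy] := eqVneq (sval u n).1 (sval u n).2.
  exists (sval u n).1; left; split=> //; move: ue.
  have [[_ _]] := tent_le (sval u n).2.
  by rewrite /gapn (valid_eq (svalP u) xy) /gap xy subrr normr0; minmax_lra.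
have [xle|xge] := ltP (`|(sval u n).1 - (sval u n).2| + (sval u n.+1).2) e.
  by exists (sval u n).1; left.
exists (sval u n).2; right; split=> //; move: ue xge eu.
by rewrite /gapn /gap; minmax_lra.
Qed.

Let at_vertex_cdist u z e : at_vertex u z e ->
  cdist (sval u) (put n (sval u) (z, z)) < e.
Proof.
move=> [[->]|[-> xy]]; apply: le_lt_trans; first exact/cdist_left/svalP.
exact: (cdist_right (svalP u)).
Qed.

Let at_vertex_peak u z e : at_vertex u z e ->
  tent (sval u n).2 - 2 * e <=
  peak (sval u n).1 (sval u n).2 (sval u n.+1).2 z.
Proof.
have xy := peak_near_left z (valid_fst (svalP u) n) (valid_snd (svalP u) n)
  (valid_snd (svalP u) n.+1).
have yx := tent_le_dist (sval u n).2 (sval u n).1; rewrite distrC in yx.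
have /andP[c0 c1] := valid_snd (svalP u) n.+1.
move=> [[zE ze]|[zE xny ze]].
  move: xy; rewrite zE eqxx mul1r ler_norml; lra.
have := peak_near_right z (valid_fst (svalP u) n) (valid_snd (svalP u) n)
  (valid_snd (svalP u) n.+1) xny.
rewrite zE eqxx mul1r ler_norml; lra.
Qed.

(** Tents are at most 1/2, and [u] lies in the half of the edge away from the end other than
    [z']. *)
Let at_vertex_peak0 u z z' e : at_vertex u z' e -> e <= 2^-1 -> z <> z' ->
  peak (sval u n).1 (sval u n).2 (sval u n.+1).2 z = 0.
Proof.
have [[_ _] tx] := tent_le (sval u n).1.
have [[_ _] ty] := tent_le (sval u n).2.
have d0 := normr_ge0 ((sval u n).1 - (sval u n).2).
have /andP[c0 c1] := valid_snd (svalP u) n.+1.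
move=> [[zE ze]|[zE xny ze]] e2 zz'; rewrite /peak.
  have -> : (z == (sval u n).1) = false by apply/eqP; rewrite -zE.
  rewrite mul0r add0r; case: eqP => _; rewrite ?mul0r ?mul1r//; minmax_lra.
have -> : (z == (sval u n).2) = false by apply/eqP; rewrite -zE.
rewrite mul0r addr0; case: eqP => _; rewrite ?mul0r ?mul1r//; minmax_lra.
Qed.

(** Gaps become small while tents stay above [e1], so points of small members are near vertices. Two
    different vertices are excluded: up to the factor [scale], the peak probe of [z] is at least
    [e1 - 2 * (e1 / 4)] at [u1] and 0 at [u], against a diameter below [e1 / 4]. *)
Lemma cluster_vertex e1 B1 : 0 < e1 -> F B1 ->
  (forall u, B1 u -> e1 <= tent (sval u n).2) -> exists p, cluster_at p.
Proof.
move=> e10 FB1 B1e.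
have S0 := live_scale_gt0 va last_word_live.
have e40 : 0 < e1 / 4 by rewrite divr_gt0.
have [B2 FB2 B2e] := Fcauchy (mulr_gt0 S0 e40).
pose B := B1 `&` B2 `&` [set u | K n a u /\ gapn u < e1 / 4].
have FB : F B by apply: filterI (last_word_gap e40); exact: filterI.
have [u1 [[B1u1 B2u1] [Ku1 gu1]]] := filter_ex FB.
have e1u1 := B1e _ B1u1.
have e12 : e1 <= 2^-1.
  by apply: le_trans e1u1 _; have [[_ _]] := tent_le (sval u1 n).2.
have [|z zu1] := at_vertex_ex gu1 _; first by lra.
have zvalid : valid (put n a (z, z)).
  rewrite (put_agree _ Ku1).
  by case: zu1 => [[-> _]|[-> _ _]]; [apply: valid_left|apply: valid_right];
    exact: svalP.
exists (exist _ _ zvalid) => e e0 C FC /=.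
have ee0 : 0 < Num.min e (e1 / 4) by rewrite lt_min e0.
have [u [[Cu [[B1u B2u] _]] [Ku gu]]] :=
  filter_ex (filterI (filterI FC FB) (last_word_gap ee0)).
have e1u := B1e _ B1u.
have [|z' zu] := at_vertex_ex gu _.
  by rewrite ge_min; apply/orP; right; lra.
exists u => //; rewrite (put_agree _ Ku).
have [zz'|zz'] := eqVneq z z'.
  rewrite zz'; apply: lt_le_trans (at_vertex_cdist zu) _.
  by rewrite ge_min lexx.
exfalso.
have z0 : peak (sval u n).1 (sval u n).2 (sval u n.+1).2 z = 0.
  apply: (at_vertex_peak0 zu); last exact/eqP.
  by rewrite ge_min; apply/orP; right; lra.
have := le_lt_trans (probe_le_cdist (svalP u1) (svalP u) n a (Some z)) (B2e _ _ B2u1 B2u).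
rewrite /probe (asboolT Ku1) (asboolT Ku) z0 mulr0 subr0 -(agree_scale Ku1).
rewrite ger0_norm ?mulr_ge0 ?peak_ge0 ?(ltW S0)// ltr_pM2l// ltNge => /negP; apply.
by apply: le_trans (at_vertex_peak zu1); lra.
Qed.

End last_word.

Lemma cobweb_cluster : exists p, cluster_at p.
Proof.
have [all_deep|] := pselect (forall n, exists v : cobweb R, F (K n (sval v))).
  exact: cluster_branch.
move=> /existsNP[m0 nm0].
have exm : exists n, `[< ~ exists v : cobweb R, F (K n (sval v)) >] by exists m0; apply/asboolP.
(* The least depth without a cylinder in [F] is positive, as the cylinder of depth 0 is the whole
   space. *)
case: (ex_minnP exm) => -[|n] /asboolP nFK minn.
  case: nFK; exists point; apply: filterS filterT => u _ m; rewrite ltn0; done.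
have [v FK] : exists v : cobweb R, F (K n (sval v)).
  apply: contrapT => nv; have := minn n (asboolT nv).
  by rewrite ltnn.
have {}nFK (w : cobweb R) : ~ F (K n.+1 (sval w)) by move=> Fw; apply: nFK; exists w.
have [small|large] := pselect (forall e : R, 0 < e -> forall B, F B ->
    exists2 u, B u & tent (sval u n).2 < e).
  exact: cluster_ends (svalP v) FK nFK small.
have [e1 [e10 [B1 [FB1 B1e]]]] : exists e1, 0 < e1 /\ exists B1, F B1 /\
    forall u, B1 u -> e1 <= tent (sval u n).2.
  apply: contrapT => nlarge; apply: large => e e0 B FB.
  apply: contrapT => nB; apply: nlarge; exists e; split=> //; exists B.
  by split=> // u Bu; rewrite leNgt; apply/negP => ue; apply: nB; exists u.
exact: (cluster_vertex (svalP v) FK (@nFK) e10 FB1 B1e).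
Qed.

End completeness.

Section complete.
Variable R : realType.

Let cobweb_cauchy_cvg (F : set_system (cobweb R)) :
  ProperFilter F -> cauchy F -> cvg F.
Proof.
move=> FF /cauchyP Fc.
have Fcauchy e : 0 < e -> exists2 B, F B &
    forall u v : cobweb R, B u -> B v -> cdist (sval u) (sval v) < e.
  move=> e0; have e20 : 0 < e / 2 by rewrite divr_gt0.
  have [x Fx] := Fc _ e20; exists (ball x (e / 2)) => // u v.
  rewrite !ballEmdist/= !cobweb_mdistE => xu xv.
  apply: le_lt_trans (cdist_triangle (svalP u) (svalP x) (svalP v)) _.
  by rewrite (cdistC (sval u)); lra.
have [p Fp] := cobweb_cluster Fcauchy.
apply/cvg_ex; exists p; apply/metricType_numDomainType.fcvgrPdist_lt => e e0.
have e20 : 0 < e / 2 by rewrite divr_gt0.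
have [B FB Be] := Fcauchy _ e20; have [u Bu up] := Fp _ e20 _ FB.
apply: filterS FB => v Bv; rewrite cobweb_mdistE.
apply: le_lt_trans (cdist_triangle (svalP p) (svalP u) (svalP v)) _.
by rewrite (cdistC (sval p)); have := Be _ _ Bu Bv; lra.
Qed.

HB.instance Definition _ := Uniform_isComplete.Build (cobweb R) cobweb_cauchy_cvg.
End complete.

(** * Connectedness *)

Lemma unit_interval_locally_constant (R : realType) (P : R -> Prop) :
  (forall x, 0 < x < 1 -> exists2 e, 0 < e &
     forall y, 0 < y < 1 -> `|x - y| < e -> (P x <-> P y)) ->
  forall x y, 0 < x < 1 -> 0 < y < 1 -> (P x <-> P y).
Proof.
move=> Ploc x y hx hy; pose I : set R := [set t | 0 < t < 1].
have Iopen t : I t -> exists2 e, 0 < e & forall s, `|t - s| < e -> I s.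
  rewrite /I/= => ht; exists (Num.min t (1 - t)); first by rewrite lt_min; lra.
  by move=> s; rewrite lt_min => /andP[]; rewrite !ltr_norml; lra.
(* Taking [P x] and [~ P x] for [Q] splits the interval into two open sets. *)
have Lopen (Q : Prop) : open [set t | I t /\ (P t <-> Q)].
  rewrite openE => t [It Pt]; have [e e0 Pe] := Ploc t It.
  have [e' e'0 Ie] := Iopen t It.
  apply/nbhs_ballP; exists (Num.min e e'); first by rewrite /= lt_min e0.
  move=> s; rewrite /ball/= lt_min => /andP[se se'].
  have Is := Ie _ se'; split=> //; have := Pe s Is se; tauto.
have Icon : connected I.
  apply/connected_intervalP => s t /= hs ht r; rewrite /I /= in hs ht *; lra.
have BI : [set t | I t /\ (P t <-> P x)] = I.
  apply: Icon; first by exists x.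
    exists [set t | I t /\ (P t <-> P x)] => //.
    by rewrite setIidr// => t [].
  exists (~` [set t | I t /\ (P t <-> ~ P x)]); first exact: open_closedC.
  apply/seteqP; split=> t [It Pt]; split=> //; first by move=> [_]; tauto.
  have {}Pt : ~ (P t <-> ~ P x) by move=> Ptx; exact: Pt.
  by have [?|?] := pselect (P t); have [?|?] := pselect (P x); tauto.
have : [set t | I t /\ (P t <-> P x)] y by rewrite BI.
by move=> [_ yx]; tauto.
Qed.

Section locally_constant.
Variables (R : realType) (Q : (nat -> R * R) -> Prop).
Implicit Types (a b : nat -> R * R) (n m k : nat) (x y t : R).
Hypothesis Qloc : forall a, valid a -> exists2 e : R, 0 < e &
  forall b, valid b -> cdist a b < e -> (Q a <-> Q b).

Let vertex_itv t := t = 0 \/ 0 < t < 1.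

Definition split_word n a := [/\ valid a, live n a & exists s t,
  [/\ vertex_itv s, vertex_itv t & ~ (Q (put n a (s, s)) <-> Q (put n a (t, t)))]].

Let valid_vertex n a t : valid a -> live n a -> vertex_itv t ->
  valid (put n a (t, t)).
Proof. by move=> va na [->|ht]; [exact: valid_trunc|exact: valid_put]. Qed.

Let unsplit n a : valid a -> live n a -> ~ split_word n a ->
  forall s t, vertex_itv s -> vertex_itv t ->
  (Q (put n a (s, s)) <-> Q (put n a (t, t))).
Proof.
by move=> va na nsp s t hs ht; apply: contrapT => nQ; apply: nsp; split=> //;
  exists s, t.
Qed.

Let put_put n a l l' : put n (put n.+1 (put n a l) l') = put n a.
Proof.
apply/funext => r; apply: put_agree => m mn.
by rewrite !putE_lt// ltnW.
Qed.

Let put0 n a l : put n.+1 (put n a l) (0, 0) = put n a l.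
Proof.
apply/funext => m; rewrite {1}/put; case: ltngtP => // nm; rewrite putE_gt//.
  exact: ltnW.
by rewrite -nm.
Qed.

Let live_put n a x y : x != y -> live n.+1 (put n a (x, y)).
Proof. by move=> xy k [<-]; rewrite putE_eq; apply/eqP. Qed.

(** If [Q] does not separate the vertices of the edge, its vertex 0 behaves like its vertices [s]
    close to 1, which converge to [y]. *)
Let split_edge n a x y : valid a -> live n a -> 0 < x < 1 -> 0 < y < 1 ->
  x != y -> ~ split_word n.+1 (put n a (x, y)) ->
  (Q (put n a (x, y)) <-> Q (put n a (y, y))).
Proof.
move=> va na hx hy xy nsp.
have vy := valid_put va na hy hy.
have vxy := valid_put va na hx hy.
have lxy := @live_put n a x y xy.
have [e e0 Qe] := Qloc vy.
pose s := 1 - Num.min e 1 / 2.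
have hs : 0 < s < 1 by rewrite /s; minmax_lra.
have se : 1 - s < e by rewrite /s; minmax_lra.
have vs := valid_put vxy lxy hs hs.
have := unsplit vxy lxy nsp (or_introl erefl) (or_intror hs).
rewrite put0 => ->; apply: iff_sym; apply: Qe => //.
rewrite cdistC; apply: le_lt_trans se.
have := @cdist_right _ _ vs n.
by rewrite putE_lt// putE_eq putE_eq put_put /=; apply.
Qed.

(** If no edge of the copy is split, [Q] agrees at [x], at the vertex 0 of the edge [(x, y)] and at
    [y] when [y] is close to [x]. So it is constant on the vertices in (0, 1), and vertices tending
    to 0 extend this to the vertex 0. *)
Let split_child n a : split_word n a -> exists b,
  split_word n.+1 b /\ agree n a b.
Proof.
move=> [va na [s [t [hs ht nQ]]]]; apply: contrapT => nsplit; apply: nQ.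
have edge x y : 0 < x < 1 -> 0 < y < 1 -> x != y ->
    (Q (put n a (x, y)) <-> Q (put n a (y, y))).
  move=> hx hy xy; apply: split_edge => // sp; apply: nsplit.
  by exists (put n a (x, y)); split=> //; exact: agree_put.
have interior x y : 0 < x < 1 -> 0 < y < 1 ->
    (Q (put n a (x, x)) <-> Q (put n a (y, y))).
  apply: (unit_interval_locally_constant (P := fun x => Q (put n a (x, x)))).
  move=> {}x hx; have vx := valid_put va na hx hx.
  have [e e0 Qe] := Qloc vx; exists e => // {}y hy xye.
  have [->//|xy] := eqVneq x y.
  have vxy := valid_put va na hx hy.
  rewrite -(edge _ _ hx hy xy); apply: Qe => //.
  rewrite cdistC; apply: le_lt_trans xye.
  have := cdist_left vxy n.
  rewrite putE_eq putE_gt//= addr0 (_ : put n (put n a (x, y)) = put n a)//.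
  by apply/funext => l; apply/esym/put_agree/agree_put.
have zero x : vertex_itv x -> (Q (put n a (0, 0)) <-> Q (put n a (x, x))).
  move=> [->//|hx]; have [e e0 Qe] := Qloc (valid_trunc va n).
  pose r : R := Num.min e 1 / 2.
  have hr : 0 < r < 1 by rewrite /r; minmax_lra.
  have re : r < e by rewrite /r; minmax_lra.
  have vr := valid_put va na hr hr.
  rewrite -(interior _ _ hr hx); apply: Qe => //.
  rewrite cdistC; apply: le_lt_trans re.
  rewrite (put_agree (0, 0) (@agree_put _ n a (r, r))).
  by apply: cdist_trunc; rewrite ?putE_eq//= tent_le.
by rewrite -(zero s hs) -(zero t ht).
Qed.

(* Nested split words shrink to a single point, near which [Q] is constant. *)
Lemma no_split_word n a : ~ split_word n a.
Proof.
move=> spa.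
have step (p : nat * (nat -> R * R)) : exists b, split_word p.1 p.2 ->
    split_word p.1.+1 b /\ agree p.1 p.2 b.
  have [/split_child[b spb]|nsp] := pselect (split_word p.1 p.2).
    by exists b.
  by exists p.2.
have [next nextP] := choice step.
pose g := fix g k := if k is k'.+1 then next ((n + k')%N, g k') else a.
have gsp k : split_word (n + k) (g k).
  elim: k => [|k IH]; first by rewrite addn0.
  by rewrite addnS; have [] := nextP ((n + k)%N, g k) IH.
have gS k : agree (n + k) (g k) (g k.+1).
  by have [] := nextP ((n + k)%N, g k) (gsp k).
have gD k j : agree (n + k) (g k) (g (k + j)%N).
  elim: j => [|j IH]; first by rewrite addn0.
  apply: agree_trans IH _; rewrite addnS; apply: agree_le (gS _).
  by rewrite leq_add2l leq_addr.
pose c m := g m.+1 m.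
have gc k : agree k (g k) c.
  move=> m mk; have := gD m.+1 (k - m.+1)%N m; rewrite subnKC// => <- //.
  exact: leq_addl.
have vc : valid c.
  by move=> m; rewrite -!(gc m.+2)//; have [] := gsp m.+2.
have [e e0 Qe] := Qloc vc.
have [k ke] := exp_half_lt e0.
have [vg lg [s [t [hs ht nQ]]]] := gsp k; apply: nQ.
have near r : vertex_itv r -> (Q c <-> Q (put (n + k) (g k) (r, r))).
  move=> hr; have vr := valid_vertex vg lg hr.
  apply: Qe => //; apply: le_lt_trans ke; apply: cdist_agree => //.
  apply: agree_trans (agree_sym (gc k)) _.
  by apply: agree_le (@agree_put _ _ _ _); exact: leq_addl.
by rewrite -(near s hs) -(near t ht).
Qed.

(** Passing from one truncation of [a] to the next goes from the vertex 0 to the vertex [(a n).2] of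
    the same copy, then to the vertex 0 of the edge [a n]. The truncations converge to [a]. *)
Lemma locally_constant_root a : valid a -> (Q a <-> Q (put 0 a (0, 0))).
Proof.
move=> va.
have trunc n : Q (put n a (0, 0)) <-> Q (put 0 a (0, 0)).
  elim: n => // n <-.
  have -> : put n.+1 a (0, 0) = put n a (a n).
    apply/funext => m; rewrite /put ltnS leq_eqVlt.
    have [->|mn] /= := eqVneq m n; first by rewrite ltnn.
    by case: ltnP => //; case: eqP.
  have [->//|an] := eqVneq (a n) (0, 0).
  have [hx hy] := valid_ne va an; have la := valid_live va (leqnn n) an.
  have := unsplit va la (@no_split_word n a) (or_introl erefl) (or_intror hy).
  move=> ->; rewrite [X in put n a X]surjective_pairing.
  have [->//|xy] := eqVneq (a n).1 (a n).2.
  by apply: split_edge => //; exact: no_split_word.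
have [e e0 Qe] := Qloc va; have [n ne] := exp_half_lt e0.
rewrite -(trunc n); apply: Qe; first exact: valid_trunc.
apply: le_lt_trans ne; apply: cdist_agree => //; first exact: valid_trunc.
exact: agree_put.
Qed.

End locally_constant.

Lemma cobweb_connected (R : realType) : connected [set: cobweb R].
Proof.
move=> B [u0 Bu0] [C oC]; rewrite setTI => BC [C' cC']; rewrite setTI => BC'.
have oB : open B by rewrite BC.
have oB' : open (~` B) by rewrite BC'; exact: closed_openC.
have openP (U : set (cobweb R)) u : open U -> U u ->
    exists2 e : R, 0 < e & forall v : cobweb R, cdist (sval u) (sval v) < e -> U v.
  rewrite openE => /[apply] /nbhs_ballP[e /= e0 eU].
  by exists e => // v uv; apply: eU.
(* This extends [B] to bare addresses, consistently by proof irrelevance. *)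
pose Q a := exists va : valid a, B (exist _ a va).
have QB u : Q (sval u) <-> B u.
  case: u => a va /=; split=> [[va']|Bu]; last by exists va.
  by rewrite (Prop_irrelevance va va').
have Qloc a : valid a -> exists2 e : R, 0 < e &
    forall b, valid b -> cdist a b < e -> (Q a <-> Q b).
  move=> va; pose u : cobweb R := exist _ a va.
  have Qu : Q a <-> B u := QB u.
  have [Bu|nBu] := pselect (B u).
    have [e e0 eB] := openP _ _ oB Bu; exists e => // b vb ab.
    have Qv : Q b <-> _ := QB (exist _ b vb).
    by have := eB (exist _ b vb) ab; tauto.
  have [e e0 eB] := openP _ _ oB' nBu; exists e => // b vb ab.
  have Qv : Q b <-> _ := QB (exist _ b vb).
  by have /= nBv : ~ B _ := eB (exist _ b vb) ab; tauto.
apply/seteqP; split=> // u _; apply/QB/(locally_constant_root Qloc (svalP u)).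
(* Truncation at depth 0 forgets the address, so all points are compared with the same root
   vertex. *)
rewrite (_ : put 0 (sval u) _ = put 0 (sval u0) (0, 0)).
  by apply/(locally_constant_root Qloc (svalP u0))/QB.
by apply: put_agree.
Qed.

(** * Distances and density *)

Section economical.
Variable R : realType.
Implicit Types (a b : nat -> R * R) (u v : cobweb R) (n m : nat).

(** The gap probe of the last of these edges is positive at [a] and vanishes at addresses that do
    not enter the edge. *)
Lemma near_agree n a : valid a -> (forall m, (m < n)%N -> (a m).1 != (a m).2) ->
  exists2 e : R, 0 < e & forall b, valid b -> cdist a b < e -> agree n a b.
Proof.
move=> va; case: n => [|n] an; first by exists 1.
have ann := valid_neq (an n (ltnSn n)).
exists (scale a n * gap (a n).1 (a n).2 (a n.+1).2).
  rewrite mulr_gt0 ?(live_scale_gt0 va (valid_live va (leqnn n) ann))//.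
  by apply: gap_gt0; [case: (valid_ne va ann)|exact: valid_snd|exact: an].
move=> b vb; apply: contraPP => nab.
apply/negP; rewrite -leNgt; apply: le_trans (probe_le_cdist va vb n a None).
by rewrite /probe (asboolT (@agree_refl _ n.+1 a)) (asboolF nab) subr0 ler_norm.
Qed.

(** The peak probe of the vertex [t] is nonzero only at addresses in the same copy whose label [n]
    has [t] as an end. *)
Lemma near_vertex n a t : valid a -> live n a -> 0 < t < 1 -> a n = (t, t) ->
  exists2 e : R, 0 < e & forall b, valid b -> cdist a b < e ->
    agree n a b /\ (t = (b n).1 \/ t = (b n).2).
Proof.
move=> va na ht an; have tv := valid_fst va n; rewrite an /= in tv.
have an1 : (a n.+1).2 = 0 by rewrite (valid_eq va)// an.
exists (scale a n * tent t).
  by rewrite mulr_gt0 ?tent_gt0// live_scale_gt0.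
move=> b vb; apply: contraPP => nab; apply/negP; rewrite -leNgt.
apply: le_trans (probe_le_cdist va vb n a (Some t)).
rewrite /probe (asboolT (@agree_refl _ n a)) an an1 /= peak_vertex// eqxx mul1r.
case: asboolP => ab; last by rewrite subr0 ler_norm.
rewrite (_ : peak _ _ _ _ = 0) ?mulr0 ?subr0 ?ler_norm// /peak.
have [tb|_] := eqVneq t (b n).1; first by case: nab; split=> //; left.
have [tb|_] := eqVneq t (b n).2; first by case: nab; split=> //; right.
by rewrite !mul0r addr0.
Qed.

(* The truncated codes [put n u (0, 0)] and the codes of the vertices joined by
   the edge [sval u n]. *)
Let piece (p : cobweb R * (nat * nat)) : nat -> R * R :=
  put p.2.1 (sval p.1)
    (match p.2.2 with
     | 0%N => (0, 0)
     | 1%N => ((sval p.1 p.2.1).1, (sval p.1 p.2.1).1)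
     | _ => ((sval p.1 p.2.1).2, (sval p.1 p.2.1).2)
     end).

(** If the first [n] labels of [u] are edges, a close point of [D] shares them. Otherwise [u] is a
    vertex of some depth [k < n]: the vertex 0 is a truncation at [k], and any other vertex is an
    end of the label [k] of a close point of [D]. *)
Lemma piece_closure (D : set (cobweb R)) u n : closure D u ->
  exists2 p, (D `*` [set: nat * nat]) p & piece p = put n (sval u) (0, 0).
Proof.
move=> Du.
have near (e : R) : 0 < e -> exists2 v, D v & cdist (sval u) (sval v) < e.
  move=> e0; have [v [Dv uv]] := Du _ (nbhsx_ballx u e e0).
  by exists v => //; move: uv; rewrite ballEmdist.
have trunc m : (forall k, (k < m)%N -> (sval u k).1 != (sval u k).2) ->
    exists2 p, (D `*` [set: nat * nat]) p & piece p = put m (sval u) (0, 0).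
  move=> um; have [e e0 eP] := near_agree (svalP u) um.
  have [v Dv uv] := near _ e0; exists (v, (m, 0%N)) => //.
  exact/put_agree/agree_sym/(eP _ (svalP v) uv).
have [alive|] := pselect (forall k, (k < n)%N -> (sval u k).1 != (sval u k).2).
  exact: trunc.
move=> /existsNP[k0 /not_implyP[k0n /negP/negPn uk0]].
have exk : exists k, (sval u k).1 == (sval u k).2 by exists k0.
case: (ex_minnP exk) => k /eqP uk kmin.
have kn : (k < n)%N by apply: leq_ltn_trans k0n; exact: kmin.
have uk_lt m : (m < k)%N -> (sval u m).1 != (sval u m).2.
  by move=> mk; apply: contraL mk => /kmin; rewrite -leqNgt.
have uE t : sval u k = (t, t) -> put n (sval u) (0, 0) = put k (sval u) (t, t).
  move=> ut; apply/funext => m; rewrite /put.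
  have [mk|km|->] := ltngtP m k; last by rewrite kn.
    by rewrite (ltn_trans mk kn).
  by rewrite (valid_dead (svalP u) uk km); case: ltnP => //; case: eqP.
have [u0|une] := eqVneq (sval u k) (0, 0).
  by rewrite (uE _ u0); exact: trunc.
have [t ut] : exists t, sval u k = (t, t).
  by exists (sval u k).1; rewrite {2}uk -surjective_pairing.
have ht : 0 < t < 1 by have [] := valid_ne (svalP u) une; rewrite ut.
have [e e0 eP] := near_vertex (svalP u) (valid_live (svalP u) (leqnn k) une) ht ut.
have [v Dv uv] := near _ e0; have [vk tv] := eP _ (svalP v) uv.
rewrite (uE _ ut) (put_agree _ vk).
by case: tv => ->; [exists (v, (k, 1%N))|exists (v, (k, 2%N))].
Qed.

Lemma cobweb_economical : economical (cobweb R).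
Proof.
move=> A Ainf; have [[DA AD] _] := densityP A.
set D := density A in DA AD *.
(* A finite [D] would be closed, hence would contain [A]. *)
have Dinf : infinite_set D.
  move=> Dfin; apply: Ainf; apply: sub_finite_set (Dfin).
  have cD : closed D.
    have /accessible_finite_set_closed := hausdorff_accessible
      (@metric_hausdorff _ (cobweb R)).
    exact.
  by move/closure_id: cD AD => <-.
pose B := piece @` (D `*` [set: nat * nat]).
have BD : B #<= D.
  apply: card_le_trans (card_image_le _ _) _.
  have /card_eqPle[nat2 _] := card_nat2.
  have natD : [set: nat * nat] #<= D.
    by apply: card_le_trans nat2 _; exact/infiniteP.
  by apply: card_le_trans (card_leX (card_lexx D) natD) _; exact: card_setXX_le.
(* By [cdist_local_eq], truncating two points two labels after their common part keeps their
   distance, and the truncations are pieces from [D]. *)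
have dB : distances A `<=` (fun p => cdist p.1 p.2) @` (B `*` B).
  move=> _ [[u v] [/= Au Av] <-]; rewrite cobweb_mdistE.
  have BP w n : A w -> B (put n (sval w) (0, 0)).
    by move=> Aw; have [p Dp <-] := piece_closure n (AD _ Aw); exists p.
  have [->|uv] := pselect (sval u = sval v).
    exists (put 0 (sval v) (0, 0), put 0 (sval v) (0, 0)); last by rewrite /= !cdistxx.
    by split; exact: BP.
  have [n [uvn uvnE]] := agree_neq uv.
  exists (put n.+2 (sval u) (0, 0), put n.+2 (sval v) (0, 0)).
    by split; exact: BP.
  apply/esym/(cdist_local_eq (n := n)) => //; try exact: svalP;
    try exact: (valid_trunc (svalP _)); exact: agree_put.
apply: card_le_trans (subset_card_le dB) _.
apply: card_le_trans (card_image_le _ _) _.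
apply: card_le_trans (card_leX BD BD) _.
exact: card_setXX_le.
Qed.

End economical.

Theorem theorem18 (R : realType) :
  exists X : completeMetricType R,
    [/\ exists x y : X, x <> y, connected [set: X]%classic & economical X].
Proof.
exists (cobweb R); split; last exact: cobweb_economical.
  (* The two points are the vertices 0 and 1/2 of the whole space. *)
  have h : 0 < (2^-1 : R) < 1 by lra.
  have v0 := @valid0 R.
  have live0 : live 0 (fun=> (0, 0) : R * R) by [].
  exists (exist _ _ v0), (exist _ _ (valid_put v0 live0 h h)).
  by move=> /(congr1 (fun u => (sval u 0%N).1)) /= /esym; lra.
exact: cobweb_connected.
Qed.
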